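(* For Lebesgue-almost every $(d_1,d_2,d_3)\in(0,1)^3$, the triangle process with decision points $d_1,d_2,d_3$ has only finitely many periodic orbits, every trajectory $(z(t))_{t\ge0}$ is eventually periodic, and every trajectory converges onto one of these periodic orbits as $t\to\infty$.
   Context: Triangle process. Fix $\lambda_1,\lambda_2,\lambda_3>0$, $\mu_1,\mu_2,\mu_3>0$ with $\rho_i:=\lambda_i/\mu_i<1$ for each $i$ and $\rho_1+\rho_2+\rho_3>1$. Put $\theta_j:=\mu_j^{-1}(\lambda_1+\lambda_2+\lambda_3)-1$. Let $e_1,e_2,e_3$ be the standard basis of $\mathbb R^3$, $A_i^0:=\{y\in\mathbb R^3: y_1+y_2+y_3=1,\ y_i=0,\ y_l\ge0\ \forall l\}$ and $A^0:=A_1^0\cup A_2^0\cup A_3^0$. For $j\in\{1,2,3\}$ and $z\in A^0\setminus A_j^0$ let $f_j(z):=\sum_{i\neq j}\frac{(\mu_j-\lambda_j)z_i+\lambda_i z_j}{(\mu_j-\lambda_j)+\mu_j\theta_j z_j}\,e_i\in A_j^0$. Let $(\hat i,\hat j,\hat k)$ denote $(1,2,3)$ or one of its cyclic permutations; the point $(1-x)e_{\hat j}+xe_{\hat k}\in A^0_{\hat i}$, $x\in[0,1]$, is written $(x,\hat i)$, with $\pi((x,\hat i)):=x$ and $\mathrm{Side}((x,\hat i)):=\hat i$. Distance: $|z-z'|_1:=\|z-z'\|/\sqrt2$ (Euclidean norm). Decision points are numbers $d_1,d_2,d_3\in(0,1)$, identified with the points $(d_{\hat i},\hat i)\in A^0_{\hat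 i}$. The switching rule is $\mathfrak R((x,\hat i))=\hat j$ if $x<d_{\hat i}$, $=\hat k$ if $x>d_{\hat i}$, and both values $\hat j,\hat k$ are allowed if $x=d_{\hat i}$. The (possibly two-valued at decision points) map is $\varphi(z):=f_{\mathfrak R(z)}(z)$. A trajectory is a sequence $(z(t))_{t\ge0}$ in $A^0$ with $z(t+1)\in\varphi(z(t))$ for all $t$. A periodic orbit is a finite sequence $u_1,\dots,u_m$ with $u_{n+1}\in\varphi(u_n)$ for $n<m$ and $u_1\in\varphi(u_m)$ (cyclic shifts are the same orbit). A trajectory is eventually $m$-periodic if there is $N$ with $\mathrm{Side}(z(n+m))=\mathrm{Side}(z(n))$ for all $n\ge N$; eventually periodic if this holds for some $m\ge1$; nonperiodic otherwise. A trajectory converges onto the orbit $u_1,\dots,u_m$ if there is $n_0\ge0$ with $|z(mt+n+n_0)-u_n|_1\to0$ as $t\to\infty$ for each $n=1,\dots,m$. *)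

(* Defs.v *)
From HB Require Import structures.
From mathcomp Require Import all_boot all_order all_algebra.
From mathcomp Require Import all_classical all_reals all_analysis.
Set Implicit Arguments. Unset Strict Implicit. Unset Printing Implicit Defensive.
Import Order.TTheory GRing.Theory Num.Theory.
Import numFieldNormedType.Exports.
Local Open Scope classical_set_scope.
Local Open Scope ring_scope.

(* Indices 1,2,3 of the paper are the ordinals 0,1,2 of 'I_3.
   Points of R^3 are row vectors 'rV[R]_3; coordinate i of z is z ord0 i. *)

Section Triangle.
Variable R : realType.
Variables (lam mu : 'I_3 -> R).

Definition nxt (i : 'I_3) : 'I_3 := inord ((i + 1) %% 3).

Definition ebasis (i : 'I_3) : 'rV[R]_3 := \row_k (if k == i then 1 else 0).

Definition inA (i : 'I_3) (y : 'rV[R]_3) : Prop :=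
  \sum_(k < 3) y ord0 k = 1 /\ y ord0 i = 0 /\ (forall l, 0 <= y ord0 l).

Definition inA0 (y : 'rV[R]_3) : Prop := exists i, inA i y.

Definition theta (j : 'I_3) : R := (\sum_(i < 3) lam i) / mu j - 1.

Definition fmap (j : 'I_3) (z : 'rV[R]_3) : 'rV[R]_3 :=
  \row_i (if i == j then 0 else
    ((mu j - lam j) * z ord0 i + lam i * z ord0 j)
      / ((mu j - lam j) + mu j * theta j * z ord0 j)).

Definition pt (i : 'I_3) (x : R) : 'rV[R]_3 :=
  (1 - x) *: ebasis (nxt i) + x *: ebasis (nxt (nxt i)).

(* Side((x,i)) := i  (the unique i with z_i = 0 for non-corner points of A^0;
   at the three corners, which can only occur as the initial point of a
   trajectory, a fixed choice is made) *)
Definition side (z : 'rV[R]_3) : 'I_3 := odflt ord0 [pick i | z ord0 i == 0].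

Variable d : 'I_3 -> R.

Definition switch (z : 'rV[R]_3) (j : 'I_3) : Prop :=
  exists (i : 'I_3) (x : R), [/\ 0 <= x <= 1, z = pt i x &
    [\/ x < d i /\ j = nxt i,
        d i < x /\ j = nxt (nxt i)
      | x = d i /\ (j = nxt i \/ j = nxt (nxt i))]].

Definition phi (z z' : 'rV[R]_3) : Prop :=
  inA0 z /\ exists j, switch z j /\ z' = fmap j z.

Definition trajectory (z : nat -> 'rV[R]_3) : Prop :=
  forall t, inA0 (z t) /\ phi (z t) (z t.+1).

(* periodic orbit u_1, ..., u_m (stored 0-indexed in a nonempty seq) *)
Definition periodic_orbit (u : seq 'rV[R]_3) : Prop :=
  [/\ (0 < size u)%N,
      forall n, (n.+1 < size u)%N -> phi (nth 0 u n) (nth 0 u n.+1)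
    & phi (nth 0 u (size u).-1) (nth 0 u 0)].

Definition eventually_periodic (z : nat -> 'rV[R]_3) : Prop :=
  exists m, (0 < m)%N /\ exists N, forall n, (N <= n)%N -> side (z (n + m)%N) = side (z n).

Definition dist1 (z z' : 'rV[R]_3) : R :=
  Num.sqrt (\sum_(i < 3) (z ord0 i - z' ord0 i) ^+ 2) / Num.sqrt 2.

Definition converges_onto (z : nat -> 'rV[R]_3) (u : seq 'rV[R]_3) : Prop :=
  exists n0 : nat, forall n, (n < size u)%N ->
    (fun t : nat => dist1 (z (size u * t + n.+1 + n0)%N) (nth 0 u n)) @ \oo --> (0 : R).

Definition same_orbit (u v : seq 'rV[R]_3) : Prop :=
  exists k r, (0 < r)%N /\ u = rot k (flatten (nseq r v)).

Definition good_decision : Prop :=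
  exists L : seq (seq 'rV[R]_3),
    [/\ forall v, v \in L -> periodic_orbit v,
        forall u, periodic_orbit u -> exists2 v, v \in L & same_orbit u v
      & forall z, trajectory z ->
          eventually_periodic z /\ exists2 v, v \in L & converges_onto z v].

End Triangle.

Definition dvec (R : realType) (p : (R * R) * R) : 'I_3 -> R :=
  fun i => if val i == 0%N then p.1.1 else if val i == 1%N then p.1.2 else p.2.

Definition lebesgue3 (R : realType) :=
  ((@lebesgue_measure R \x @lebesgue_measure R) \x @lebesgue_measure R)%E.

(* Main.v *)
(* The projective maps f_j become contractions in the logarithmic ratio of the two
   nonzero coordinates, uniformly so on the part of the side where the switching
   rule applies them. The triangle process is thus a piecewise contraction of three
   lines, each cut at one point. If, after some time, all orbits stay at a positive
   distance from the cuts, two orbit points in a common small cell never separate,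
   so by the pigeonhole principle every orbit is attracted by a periodic one, and
   there are at most as many periodic points as cells.
   For almost every triple of cuts this holds. Discard the null set of triples for
   which a composition of branches maps a cut to a cut. Near any other triple a
   critical state, i.e. one where the branch is undetermined, is followed by K
   noncritical ones, with K as large as we please. Hence only 2^q families of words
   of length qK matter, and the points they reach lie in intervals of total length
   O((2 kap^K)^q), where kap is the contraction rate. The cuts of a bad triple come
   arbitrarily close to these points, so bad triples form a null set. *)
Require Import Defs.
From HB Require Import structures.
From mathcomp Require Import all_boot all_order all_algebra.
From mathcomp Require Import all_classical all_reals all_analysis.
From mathcomp Require Import ring lra zify.
Set Implicit Arguments. Unset Strict Implicit. Unset Printing Implicit Defensive.
Import Order.TTheory GRing.Theory Num.Theory.
Import numFieldNormedType.Exports.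
Local Open Scope classical_set_scope.
Local Open Scope ring_scope.

(** * Contractions, finite grids and repeated sequences *)

Lemma contraction_fixpoint (R : realType) (k : R) (f : R -> R) :
  0 <= k < 1 -> (forall x y, `|f x - f y| <= k * `|x - y|) -> exists x, f x = x.
Proof.
move=> /andP[k0 k1] lipf.
have ctr : @is_contraction R R^o R^o setT setT (totalfun f).
  by exists (NngNum k0); split => //= -[x y] _ /=; exact: lipf.
have [x _ xE] := banach_fixed_point ctr closedT (ex_intro _ 0 I).
by exists x.
Qed.

Lemma geometric_small (R : realType) (k C e : R) :
  0 <= k < 1 -> 0 < e -> exists n, C * k ^+ n <= e.
Proof.
move=> /andP[k0 k1] e0.
have /cvgrPdist_lt/(_ _ e0)[n _ /(_ n (leqnn n)) /=] :
    (geometric C k : R^nat) @ \oo --> (0 : R).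
  by apply: cvg_geometric; rewrite ger0_norm.
by rewrite sub0r normrN => /(le_lt_trans (ler_norm _)) /ltW; exists n.
Qed.

Lemma le_geometric (R : realType) (k C x y : R) :
  0 <= k < 1 -> (forall n, x - y <= C * k ^+ n) -> x <= y.
Proof.
move=> k01 xy; rewrite leNgt; apply/negP => yx.
have [|n] := @geometric_small R k C ((x - y) / 2) k01; first lra.
by have := xy n; lra.
Qed.

Lemma finite_lower_bound (R : realType) (T : finType) (F : T -> R) :
  (forall t, 0 < F t) -> exists2 e, 0 < e & forall t, e <= F t.
Proof.
move=> F0; exists (\big[Num.min/1]_t F t).
  by elim/big_ind: _ => // x y x0 y0; rewrite lt_min x0.
by move=> t; exact: bigmin_le_cond.
Qed.

(** The cells are intervals of length [e] counted from [- H]; no cell number exceeds [tr H] on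
    [[- H, H]], so [inord] loses nothing there. *)
Lemma finite_cells (R : realType) (H e : R) : 0 < e ->
  exists N, exists cell : R -> 'I_N.+1, forall x y,
    `|x| <= H -> `|y| <= H -> cell x = cell y -> `|x - y| < e.
Proof.
move=> e0; pose tr x := Num.truncn ((x + H) / e).
exists (tr H), (fun x => inord (tr x)) => x y; rewrite !ler_norml.
move=> /andP[x1 x2] /andP[y1 y2] /(congr1 val) /=.
have trH z : z <= H -> (tr z < (tr H).+1)%N.
  by move=> zH; rewrite ltnS le_truncn// ler_pM2r ?invr_gt0//; lra.
rewrite !inordK ?trH// => trxy.
have nn z : - H <= z -> 0 <= (z + H) / e by move=> ?; apply: divr_ge0; lra.
have /andP[x3 x4] := truncn_itv (nn _ x1).
have /andP[y3 y4] := truncn_itv (nn _ y1).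
rewrite -/(tr x) -/(tr y) trxy -natr1 in x3 x4 y3 y4.
have : `|(x + H) / e - (y + H) / e| < 1 by rewrite ltr_norml; lra.
rewrite -mulrBl normrM [`|e^-1|]gtr0_norm ?invr_gt0// ltr_pdivrMr// mul1r.
by rewrite opprD addrACA subrr addr0.
Qed.

Lemma pigeonhole (T : finType) (f : nat -> T) :
  exists t m, (0 < m)%N /\ f (t + m)%N = f t.
Proof.
have /injectivePn[i [j ij fij]] : ~~ injectiveb (fun i : 'I_#|T|.+1 => f i).
  by apply/negP => /injectiveP /leq_card; rewrite card_ord ltnn.
wlog lt_ij : i j ij fij / (i < j)%N.
  move=> wl; have [/wl|ji|/val_inj ijE] := ltngtP i j; first exact.
    by apply: (wl j i) => //; rewrite eq_sym.
  by rewrite ijE eqxx in ij.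
by exists (val i), (j - i)%N; split; [rewrite subn_gt0|rewrite (subnKC (ltnW lt_ij))].
Qed.

Lemma nth_flatten_nseq (T : Type) (x0 : T) (r n : nat) (v : seq T) :
  (n < r * size v)%N ->
  nth x0 (flatten (nseq r v)) n = nth x0 v (n %% size v).
Proof.
elim: r n => // r IH n; rewrite mulSn /= nth_cat => nr.
case: ltnP => [nv|vn]; first by rewrite modn_small.
by rewrite IH; [rewrite -[in RHS](subnK vn) modnDr | lia].
Qed.

(** * Sets of content zero *)

Lemma uniform_net (R : realType) (M : R) n x : 0 < M -> `|x| <= M ->
  exists t : 'I_n.+2, `|x - (2 * M / n.+1%:R * t%:R - M)| <= 2 * M / n.+1%:R.
Proof.
move=> M0; rewrite ler_norml => /andP[x1 x2].
set s := 2 * M / _.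
have s0 : 0 < s by apply: divr_gt0; rewrite ?ltr0Sn//; lra.
have t0 : 0 <= (x + M) / s by apply: divr_ge0; lra.
have tn : (Num.truncn ((x + M) / s) < n.+2)%N.
  rewrite ltnS truncn_le_nat (@le_lt_trans _ _ n.+1%:R) ?ltr_nat//.
  rewrite ler_pdivrMr// /s mulrCA divff ?mulr1; first lra.
  by rewrite pnatr_eq0.
exists (Ordinal tn) => /=.
have /andP[t1 t2] := truncn_itv t0.
rewrite ler_pdivlMr// in t1; rewrite ltr_pdivrMr// -natr1 mulrDl mul1r in t2.
by rewrite ler_norml; lra.
Qed.

Lemma prod_if (R : realType) (I : finType) (j : I) (x y : R) :
  \prod_l (if l == j then x else y) = x * y ^+ #|I|.-1.
Proof.
rewrite (bigD1 j)//= eqxx; congr (_ * _).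
rewrite (eq_bigr (fun=> y)) => [|l /negbTE->//].
by rewrite prodr_const -(cardC1 j).
Qed.

Section ContentZero.
Variables (R : realType) (I : finType).
Implicit Types (A : set (I -> R)).

(** Jordan content zero, with closed boxes of centre [a t] and half-widths [r t]. The notion needs
    no measure on [I -> R]. *)
Definition content0 A := forall eps : R, 0 < eps ->
  exists (T : finType) (a r : T -> I -> R),
    [/\ forall t i, 0 <= r t i,
        forall c, A c -> exists t, forall i, `|c i - a t i| <= r t i
      & \sum_t \prod_i (2 * r t i) <= eps].

Definition sigma_content0 A := exists F : nat -> set (I -> R),
  (forall n, content0 (F n)) /\ A `<=` \bigcup_n F n.

Lemma content0_set0 : content0 set0.
Proof.
move=> eps /ltW e0; exists 'I_0, (fun _ _ => 0), (fun _ _ => 0).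
by split=> //; rewrite big_ord0.
Qed.

Lemma sigma_content0_countable (T : countType) (F : T -> set (I -> R)) A :
  (forall t, content0 (F t)) -> (forall c, A c -> exists t, F t c) ->
  sigma_content0 A.
Proof.
move=> F0 AF; exists (fun n => if unpickle n is Some t then F t else set0); split.
  by move=> n; case: unpickle => [t|]; [exact: F0 | exact: content0_set0].
by move=> c /AF[t tc]; exists (pickle t) => //; rewrite pickleK.
Qed.

End ContentZero.

(** * Piecewise contractions of finitely many lines *)

Section Dynamics.
Variables (R : realType) (I : finType) (tgt : I -> bool -> I).
Variable g : I -> bool -> R -> R.
Variables (kap H : R) (s0 : I * R).
Hypothesis kap01 : 0 < kap < 1.
Hypothesis g_lip : forall i b x y, `|g i b x - g i b y| <= kap * `|x - y|.
Hypothesis g_bnd : forall i b x, `|g i b x| <= H.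

Implicit Types (s e : I * R) (c cs : I -> R) (o : nat -> I * R).
Implicit Types (u v : seq (I * R)).

Definition move b s := (tgt s.1 b, g s.1 b s.2).

(** At the cut both branches are allowed, so the dynamics is two-valued there. The inequalities are
    weak and therefore survive limits. *)
Definition allowed c s b := if b then c s.1 <= s.2 else s.2 <= c s.1.

Definition step c s s' := exists2 b, allowed c s b & s' = move b s.

Definition is_orbit c o := forall t, step c (o t) (o t.+1).

Definition clear c (eps : R) o := forall t, eps <= `|(o t).2 - c (o t).1|.

(** The waiting time [n] and the margin [eps] are common to all orbits, so one finite partition into
    cells can serve them all. *)
Definition avoids c := exists n, exists2 eps, 0 < eps &
  forall o, is_orbit c o -> clear c eps (fun t => o (n + t)%N).

Let kap0 : 0 <= kap. Proof. by case/andP: kap01 => /ltW. Qed.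
Let kap_lt1 : kap < 1. Proof. by case/andP: kap01. Qed.

Lemma ler_kapX (x y d : R) n : 0 <= d -> `|x - y| <= kap ^+ n * d -> `|x - y| <= d.
Proof.
move=> d0 /le_trans; apply; rewrite ler_piMl// exprn_ile1//; exact: ltW.
Qed.

Lemma orbit_shift c o k : is_orbit c o -> is_orbit c (fun t => o (k + t)%N).
Proof. by move=> oo t; rewrite addnS; exact: oo. Qed.

Lemma orbit_bounded c o t : is_orbit c o -> (0 < t)%N -> `|(o t).2| <= H.
Proof. by case: t => // t oo _; have [b _ ->] := oo t; exact: g_bnd. Qed.

Lemma allowed_clear c s b eps : 0 < eps -> eps <= `|s.2 - c s.1| ->
  allowed c s b -> b = (c s.1 < s.2).
Proof.
move=> e0; rewrite /allowed ler_normr => /orP h; case: b => h2; apply/esym.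
  by case: h => h; lra.
by apply/negbTE; rewrite -leNgt.
Qed.

(** States on opposite sides of a cut, each at distance at least [eps] from it, are at least
    [2 * eps] apart. *)
Lemma clear_close c s s' eps : eps <= `|s.2 - c s.1| -> eps <= `|s'.2 - c s'.1| ->
  s.1 = s'.1 -> `|s.2 - s'.2| < eps -> (c s.1 < s.2) = (c s'.1 < s'.2).
Proof.
move=> + + ss'; rewrite -ss' !ler_normr ltr_norml {ss'} => /orP[]h1 /orP[]h2 /andP[h3 h4].
- by apply/idP/idP; lra.
- exfalso; lra.
- exfalso; lra.
- by apply/idP/idP; lra.
Qed.

Lemma orbit_step c o eps t : 0 < eps -> is_orbit c o -> clear c eps o ->
  o t.+1 = move (c (o t).1 < (o t).2) (o t).
Proof. by move=> e0 oo cl; have [b /(allowed_clear e0 (cl t)) <-] := oo t. Qed.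

Lemma move_close b s s' : s.1 = s'.1 ->
  (move b s).1 = (move b s').1 /\
  `|(move b s).2 - (move b s').2| <= kap * `|s.2 - s'.2|.
Proof. by move=> ss'; rewrite /= ss'; split => //; exact: g_lip. Qed.

(** As long as the states are closer than [eps] they lie on the same side of the cut; the same
    branch then acts on both and brings them closer. *)
Lemma synchronized c eps o o' : 0 < eps ->
  is_orbit c o -> is_orbit c o' -> clear c eps o -> clear c eps o' ->
  (o 0%N).1 = (o' 0%N).1 -> `|(o 0%N).2 - (o' 0%N).2| < eps ->
  forall t, (o t).1 = (o' t).1 /\
    `|(o t).2 - (o' t).2| <= kap ^+ t * `|(o 0%N).2 - (o' 0%N).2|.
Proof.
move=> e0 oo oo' cl cl' o1 o2; elim=> [|t [IH1 IH2]].
  by split => //; rewrite expr0 mul1r.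
rewrite (orbit_step t e0 oo cl) (orbit_step t e0 oo' cl').
rewrite (clear_close (cl t) (cl' t) IH1); last exact: le_lt_trans (ler_kapX _ IH2) o2.
have [-> h] := move_close (c (o' t).1 < (o' t).2) IH1; split => //.
by apply: (le_trans h); rewrite exprS -mulrA ler_wpM2l.
Qed.

(** The branches are prescribed, [allowed] or not: the periodic orbit is built first and shown
    admissible afterwards. *)
Fixpoint itinerary (b : nat -> bool) s n : I * R :=
  if n is n'.+1 then move (b n') (itinerary b s n') else s.

Lemma itinerary_close b s s' n : s.1 = s'.1 ->
  (itinerary b s n).1 = (itinerary b s' n).1 /\
  `|(itinerary b s n).2 - (itinerary b s' n).2| <= kap ^+ n * `|s.2 - s'.2|.
Proof.
move=> ss'; elim: n => [|n [IH1 IH2]]; first by rewrite /= expr0 mul1r.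
have [h1 h2] := move_close (b n) IH1; split => //=.
by apply: (le_trans h2); rewrite exprS -mulrA ler_wpM2l.
Qed.

Lemma itinerary_periodic b s m : (forall n, b (n + m)%N = b n) ->
  itinerary b s m = s -> forall n, itinerary b s (n + m) = itinerary b s n.
Proof. by move=> bm sm; elim=> [|n IH] //; rewrite addSn /= bm IH. Qed.

(** A near return synchronizes [o] with its own shift by [m], so the sequence of branches has period
    [m]. The fixed point of the [m]-step map then follows this sequence periodically and attracts
    [o]. *)
Lemma recurrent_shadow c eps o m : 0 < eps -> (0 < m)%N ->
  is_orbit c o -> clear c eps o ->
  (o m).1 = (o 0%N).1 -> `|(o m).2 - (o 0%N).2| < eps ->
  exists2 o', is_orbit c o' /\ (forall n, o' (n + m)%N = o' n) &
  exists C, forall n, (o n).1 = (o' n).1 /\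
    `|(o n).2 - (o' n).2| <= C * kap ^+ n.
Proof.
move=> e0 m0 oo cl om1 om2.
pose b n := c (o n).1 < (o n).2.
have oE n : o n = itinerary b (o 0%N) n.
  by elim: n => //= n <-; exact: (orbit_step n e0 oo cl).
have sync := synchronized e0 (orbit_shift m oo) oo (fun t => cl (m + t)%N) cl.
rewrite addn0 in sync; have {}sync := sync om1 om2.
have bm n : b (n + m)%N = b n.
  have [h1 h2] := sync n; rewrite addnC.
  apply: (clear_close (cl _) (cl _) h1).
  exact: le_lt_trans (ler_kapX _ h2) om2.
set i := (o 0%N).1 in om1.
have [||z zE] := @contraction_fixpoint R (kap ^+ m) (fun x => (itinerary b (i, x) m).2).
- by rewrite exprn_ge0//= exprn_ilt1// -?lt0n.
- by move=> x y; have [] := @itinerary_close b (i, x) (i, y) m erefl.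
have zm : itinerary b (i, z) m = (i, z).
  apply: injective_projections => //=.
  by have [-> _] := @itinerary_close b (i, z) (o 0%N) m erefl; rewrite -oE.
have o'm := itinerary_periodic bm zm.
have close n := @itinerary_close b (o 0%N) (i, z) n erefl.
set C := `|_ - (i, z).2| in close.
have C0 : 0 <= C by exact: normr_ge0.
exists (itinerary b (i, z)); last first.
  by exists C => n; rewrite mulrC oE; exact: close.
split=> // n; exists (b n) => //.
have bq q : b (n + q * m)%N = b n.
  by elim: q => [|q IH]; rewrite ?addn0// mulSnr addnA bm IH.
have oq q : itinerary b (i, z) (n + q * m) = itinerary b (i, z) n.
  by elim: q => [|q IH]; rewrite ?addn0// mulSnr addnA o'm IH.
(* At the times [n + q * m] the periodic orbit is in one fixed state, to which [o] converges, and
   [o] uses the branch [b n] each time; the weak inequality in [allowed] passes to the limit. *)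
have far q : (o (n + q * m)).1 = (itinerary b (i, z) n).1 /\
    `|(o (n + q * m)).2 - (itinerary b (i, z) n).2| <= C * kap ^+ q.
  have [h1 h2] := close (n + q * m)%N.
  rewrite -oE oq in h1 h2; split => //; apply: (le_trans h2).
  rewrite mulrC ler_wpM2l// ler_wiXn2l//; last nia.
  exact: ltW.
have k01 : 0 <= kap < 1 by rewrite kap0.
rewrite /allowed; case: (b n) bq => bq; apply: (le_geometric (C := C) k01) => q.
  have [h1 /ler_normlP[h2 h3]] := far q.
  by have := bq q; rewrite /b h1; lra.
have [h1 /ler_normlP[h2 h3]] := far q.
by have /negbT := bq q; rewrite /b h1 -leNgt; lra.
Qed.

Definition periodic c u := [/\ (0 < size u)%N,
  forall n, (n.+1 < size u)%N -> step c (nth s0 u n) (nth s0 u n.+1)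
  & step c (nth s0 u (size u).-1) (nth s0 u 0)].

Definition unroll u n : I * R := nth s0 u (n %% size u).

Lemma unroll_orbit c u : periodic c u -> is_orbit c (unroll u).
Proof.
case=> u0 ustep uloop t; rewrite /unroll.
have := ltn_pmod t u0; set k := (t %% size u)%N => ku.
have [kl|kl] := ltnP k.+1 (size u).
  by rewrite -addn1 -modnDml -/k addn1 (modn_small kl); exact: ustep.
have kE : k.+1 = size u by apply/eqP; rewrite eqn_leq ku.
rewrite -addn1 -modnDml -/k addn1 kE modnn.
by have -> : k = (size u).-1 by rewrite -kE.
Qed.

Lemma periodic_mkseq c o m : (0 < m)%N -> is_orbit c o ->
  (forall n, o (n + m)%N = o n) -> periodic c (mkseq o m).
Proof.
move=> m0 oo om; split => [|n|]; rewrite size_mkseq//.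
  by move=> nm; rewrite !nth_mkseq// 1?ltnW.
have om0 : o m = o 0%N by rewrite -(om 0%N).
by rewrite !nth_mkseq ?prednK// -om0 -{2}(prednK m0).
Qed.

Lemma unroll_mkseq o m : (0 < m)%N -> (forall n, o (n + m)%N = o n) ->
  forall n, unroll (mkseq o m) n = o n.
Proof.
move=> m0 om n; rewrite /unroll size_mkseq nth_mkseq ?ltn_pmod//.
rewrite {2}(divn_eq n m) addnC; elim: (n %/ m)%N => [|q IH]; first by rewrite addn0.
by rewrite mulSnr addnA om.
Qed.

Lemma unroll_addM u n q : unroll u (n + q * size u) = unroll u n.
Proof. by rewrite /unroll addnC modnMDl. Qed.

(** Periodic orbits that start on one line in one cell of diameter below [eps] coincide, so [L]
    needs one shortest word per line and cell. Any orbit revisits some cell of some line and is then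
    attracted by a periodic one. *)
Lemma avoids_finite c : avoids c ->
  exists L : seq (seq (I * R)), [/\ forall v, v \in L -> periodic c v,
    forall u, periodic c u -> exists2 v, v \in L &
      exists2 r, (0 < r)%N & u = flatten (nseq r v)
    & forall o, is_orbit c o -> exists2 v, v \in L &
        exists t0 C, forall n, (o (t0 + n)%N).1 = (unroll v n).1 /\
          `|(o (t0 + n)%N).2 - (unroll v n).2| <= C * kap ^+ n].
Proof.
case=> n0 [eps e0 av].
have [N [cell cellP]] := finite_cells H e0.
have start u : periodic c u -> `|(unroll u 0).2| <= H.
  move=> pu; have [u0 _ _] := pu; rewrite -(unroll_addM u 0 1) add0n mul1n.
  exact: orbit_bounded (unroll_orbit pu) u0.
(* Adding [n0] periods moves any time past [n0], so a periodic orbit is clear from its start. *)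
have pclear u : periodic c u -> clear c eps (unroll u).
  move=> pu t; have [u0 _ _] := pu.
  rewrite -(unroll_addM u t n0).
  rewrite (_ : t + n0 * size u = n0 + (t + n0 * (size u).-1))%N; last by nia.
  exact: av (unroll_orbit pu) _.
have sameorbit u v : periodic c u -> periodic c v ->
    (unroll u 0).1 = (unroll v 0).1 ->
    cell (unroll u 0).2 = cell (unroll v 0).2 ->
    forall t, unroll u t = unroll v t.
  move=> pu pv h1 h2.
  have h3 := cellP _ _ (start u pu) (start v pv) h2.
  have sy := synchronized e0 (unroll_orbit pu) (unroll_orbit pv)
    (pclear u pu) (pclear v pv) h1 h3.
  (* After [size u * size v] steps both orbits are back at their starts, yet their distance has
     shrunk by a factor below 1. *)
  have d0 : `|(unroll u 0).2 - (unroll v 0).2| = 0.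
    have [_] := sy (size v * size u)%N.
    rewrite -{1}[(_ * _)%N]add0n unroll_addM [(size v * _)%N]mulnC.
    rewrite -{1}[(size u * _)%N]add0n unroll_addM.
    have kv : kap ^+ (size u * size v) < 1.
      have [[u0 _ _] [v0 _ _]] := (pu, pv).
      by rewrite exprn_ilt1// -lt0n muln_gt0 u0.
    move: `|_| (normr_ge0 ((unroll u 0).2 - (unroll v 0).2)) => w w0 hw.
    by apply/eqP; rewrite eq_le w0 andbT; nra.
  move=> t; have [t1 t2] := sy t; rewrite d0 mulr0 normr_le0 subr_eq0 in t2.
  by apply: injective_projections => //; exact/eqP.
pose key u := ((unroll u 0).1, cell (unroll u 0).2).
(* For each key, [l] holds a periodic word of least length if there is one, and nothing
   otherwise. *)
have /choice[l lP] (t : I * 'I_N.+1) : exists l : seq (seq (I * R)),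
    (forall v, v \in l -> periodic c v) /\
    forall u, periodic c u -> key u = t -> exists2 v, v \in l & key v = t /\
      forall w, periodic c w -> key w = t -> (size v <= size w)%N.
  pose P n := `[< exists2 u, periodic c u & key u = t /\ size u = n >].
  case: (pselect (exists n, P n)) => [exP|nP]; last first.
    exists [::]; split => // u pu ut; case: nP; exists (size u).
    by apply/asboolP; exists u.
  case: (ex_minnP exP) => n /asboolP[v pv [vt vn]] nmin; exists [:: v]; split.
    by move=> w; rewrite inE => /eqP->.
  move=> _ _ _; exists v; rewrite ?inE//; split => // w pw wt; rewrite vn.
  by apply: nmin; apply/asboolP; exists w.
pose L := flatten [seq l t | t <- enum {: I * 'I_N.+1}].
have lL t v : v \in l t -> v \in L.
  by move=> vt; apply/flattenP; exists (l t) => //; apply: map_f; rewrite mem_enum.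
have LP v : v \in L -> periodic c v.
  by move=> /flattenP[_ /mapP[t _ ->]]; have [h _] := lP t; exact: h.
have rep u : periodic c u -> exists2 v, v \in L &
    (forall t, unroll u t = unroll v t) /\
    forall w, periodic c w -> key w = key u -> (size v <= size w)%N.
  move=> pu; have [_ h] := lP (key u); have [v vl [vu vmin]] := h u pu erefl.
  exists v; first exact: lL vl.
  by split => //; case: vu => k1 k2; apply: sameorbit => //; exact: LP (lL _ _ vl).
exists L; split=> // [u pu|o oo].
  have [v vL [uv vmin]] := rep u pu; exists v => //.
  have [[u0 _ _] [v0 _ _]] := (pu, LP v vL).
  (* A nonzero remainder would itself be a period, shorter than the minimal length [size v]. *)
  have uv0 : (size u %% size v)%N = 0%N.
    apply/eqP; rewrite -leqn0 leqNgt; apply/negP => r0.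
    have per n : unroll u (n + size u %% size v) = unroll u n.
      rewrite uv -(unroll_addM v _ (size u %/ size v)) -addnA [(_ %% _ + _)%N]addnC.
      by rewrite -divn_eq -uv -(mul1n (size u)) unroll_addM.
    have := vmin _ (periodic_mkseq r0 (unroll_orbit pu) per).
    rewrite size_mkseq /key unroll_mkseq// => /(_ erefl).
    by rewrite leqNgt ltn_pmod.
  have uE : size u = (size u %/ size v * size v)%N.
    by rewrite {1}(divn_eq (size u) (size v)) uv0 addn0.
  exists (size u %/ size v)%N; first by rewrite divn_gt0// dvdn_leq// /dvdn uv0.
  apply: (@eq_from_nth _ s0).
    by rewrite size_flatten /shape map_nseq sumn_nseq mulnC.
  move=> n nu; rewrite nth_flatten_nseq -?uE//.
  by have := uv n; rewrite {1}/unroll modn_small.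
(* Skipping [n0] steps gives clearness; one more ensures the bound [H], which holds only for images
   of a branch. *)
pose o1 t := o (n0.+1 + t)%N.
have o1o : is_orbit c o1 := orbit_shift _ oo.
have o1b t : `|(o1 t).2| <= H by exact: orbit_bounded oo _.
have o1c : clear c eps o1.
  by move=> t; rewrite /o1 addSnnS; exact: av oo _.
have [t [m [m0 [f1 f2]]]] := pigeonhole (fun t => ((o1 t).1, cell (o1 t).2)).
have := @recurrent_shadow c eps (fun n => o1 (t + n)%N) m e0 m0 (orbit_shift t o1o).
rewrite addn0; case=> //; first by apply: cellP f2; exact: o1b.
move=> op [opo opm] [C close].
have [v vL [uv _]] := rep _ (periodic_mkseq m0 opo opm).
exists v => //; exists (n0.+1 + t)%N, C => n.
by have := close n; rewrite -uv unroll_mkseq// -addnA.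
Qed.

(** * Words of branches and connections between cuts *)

Implicit Types (w : seq bool).

Definition run w s := foldl (fun s b => move b s) s w.

Lemma run_close w s s' : s.1 = s'.1 ->
  (run w s).1 = (run w s').1 /\
  `|(run w s).2 - (run w s').2| <= kap ^+ size w * `|s.2 - s'.2|.
Proof.
elim: w s s' => [|b w IH] s s' ss'; first by rewrite /= expr0 mul1r.
have [h1 h2] := move_close b ss'.
have [h3 h4] := IH _ _ h1; split => //=.
apply: (le_trans h4); rewrite exprSr -mulrA ler_wpM2l// exprn_ge0//.
Qed.

Definition cut_connection (M : R) w i : set (I -> R) :=
  [set c | (forall l, `|c l| <= M) /\ (run w (i, c i)).2 = c (run w (i, c i)).1].

Lemma run_side w i x y : (run w (i, x)).1 = (run w (i, y)).1.
Proof. by have [] := @run_close w (i, x) (i, y) erefl. Qed.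

(** If [w] leads back to line [i], then [c i] is the unique fixed point of a contraction and [c]
    lies in a hyperplane. Otherwise [w] leads to another line [j], and [c j] is a Lipschitz function
    of [c i]. *)
Lemma cut_connection_content0 M w i : 0 < M -> w != [::] ->
  content0 (cut_connection M w i).
Proof.
move=> M0 w0 eps e0.
pose j := (run w (i, 0)).1.
have [ij|ij] := eqVneq i j.
  have [[c0 [_ c0w]]|noc] := pselect (exists c, cut_connection M w i c); last first.
    have [T [a [r [? _ ?]]]] := @content0_set0 R I eps e0.
    by exists T, a, r; split => // c ic; case: noc; exists c.
  pose V : R := (2 * M) ^+ #|I|.-1.
  have V0 : 0 < V by apply: exprn_gt0; lra.
  (* A single slab around the hyperplane; its half-width is chosen to make the volume exactly
     [eps]. *)
  exists unit, (fun _ l => if l == i then c0 i else 0),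
    (fun _ l => if l == i then eps / (2 * V) else M); split.
  - by move=> _ l; case: ifP => _; [apply: divr_ge0; lra | lra].
  - move=> c [cM cw]; exists tt => l; case: eqP => [->|_]; last by rewrite subr0.
    rewrite (run_side w i _ 0) -/j -ij in cw; rewrite (run_side w i _ 0) -/j -ij in c0w.
    have [_ /=] := @run_close w (i, c i) (i, c0 i) erefl; rewrite cw c0w => h.
    have kw : kap ^+ size w < 1 by rewrite exprn_ilt1// size_eq0.
    have -> : `|c i - c0 i| = 0.
      move: `|_| (normr_ge0 (c i - c0 i)) h => z z0 h.
      by apply/eqP; rewrite eq_le z0 andbT; nra.
    by apply: divr_ge0; lra.
  - rewrite big_const card_unit /= addr0.
    under eq_bigr => l _ do rewrite fun_if.
    rewrite prod_if -/V.
    rewrite [leLHS](_ : _ = eps)//; field; lra.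
pose V : R := \prod_(l | (l != i) && (l != j)) (2 * M).
have V0 : 0 <= V by apply: prodr_ge0 => l _; lra.
have M2V : 0 <= 32 * M ^+ 2 * V by rewrite mulr_ge0// mulr_ge0// sqr_ge0.
(* With [N = n + 1], the graph is covered by [N + 1] boxes of volume [4 * d ^+ 2 * V] where
   [d = 2 * M / N]; as [N + 1 <= 2 * N], they total at most [32 * M ^+ 2 * V / N]. *)
pose n := Num.truncn (32 * M ^+ 2 * V / eps).
have nV : 32 * M ^+ 2 * V / eps < n.+1%:R by exact: truncnS_gt.
pose d : R := 2 * M / n.+1%:R.
have d0 : 0 < d by apply: divr_gt0; rewrite ?ltr0Sn//; lra.
pose x (t : 'I_n.+2) : R := d * t%:R - M.
exists 'I_n.+2,
  (fun t l => if l == i then x t else if l == j then (run w (i, x t)).2 else 0),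
  (fun t l => if (l == i) || (l == j) then d else M); split.
- by move=> t l; case: ifP => _; lra.
- move=> c [cM cw]; have [t xt] := uniform_net n M0 (cM i); exists t => l.
  case: eqP => [->//|_] /=; case: eqP => [->|_]; last by rewrite subr0.
  have [_ /=] := @run_close w (i, c i) (i, x t) erefl.
  rewrite cw (run_side w i _ 0) -/j => h; apply: (le_trans h).
  apply: le_trans xt; rewrite ler_piMl// exprn_ile1//; exact: ltW.
- have vol : \prod_l (2 * (if (l == i) || (l == j) then d else M)) = 4 * d ^+ 2 * V.
    rewrite (bigD1 i)//= eqxx /= (bigD1 j) 1?eq_sym//= eqxx orbT.
    rewrite (eq_bigr (fun=> 2 * M)) => [|l /andP[/negbTE-> /negbTE->]//].
    by rewrite -/V; ring.
  rewrite /=; under eq_bigr => t _ do rewrite vol.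
  rewrite sumr_const card_ord -[leLHS]mulr_natl /d.
  have N0 : 0 < n.+1%:R :> R by rewrite ltr0Sn.
  have N1 : 1 <= n.+1%:R :> R by rewrite ler1n.
  rewrite ltr_pdivrMr// in nV; rewrite -(natr1 n.+1).
  move: n.+1%:R N0 N1 nV => N N0 N1 nV.
  rewrite [leLHS](_ : _ = (N + 1) * (16 * M ^+ 2 * V) / N ^+ 2); last by field; lra.
  rewrite ler_pdivrMr ?exprn_gt0//.
  set W := M ^+ 2 * V.
  have W0 : 0 <= W by rewrite mulr_ge0// sqr_ge0.
  have -> : 16 * M ^+ 2 * V = 16 * W by rewrite /W mulrA.
  have nW : 32 * W < N * eps by rewrite /W mulrA.
  nra.
Qed.

(** * The tree of undetermined branches near reference decision points *)

Section Tree.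
Variables (cs : I -> R) (del : R) (K : nat).
Hypothesis del0 : 0 < del.

(* Only at states within [2 * del] of a reference decision point do the
   decision points [del]-close to [cs] leave the next branch undetermined. *)
Definition critical s := `|s.2 - cs s.1| <= 2 * del.

(** Only [cs] and [del] enter, so one list of states serves all decision points [del]-close to
    [cs]. *)
Fixpoint leaves n s : seq (I * R) :=
  if n is n'.+1 then
    if critical s then leaves n' (move false s) ++ leaves n' (move true s)
    else leaves n' (move (cs s.1 < s.2) s)
  else [:: s].

(** A quantitative absence of cut connections. Of the [4 * del], one half absorbs the distance of a
    critical state from its cut, and the other half exceeds the threshold of [critical] on
    arrival. *)
Definition gapped := forall w i, (0 < size w <= K)%N ->
  4 * del < `|(run w (i, cs i)).2 - cs (run w (i, cs i)).1|.

(** At a noncritical [s] the distance to the reference cut exceeds [2 * del], while cut and state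
    are each displaced by at most [del]; the orbit must then take the branch chosen by [cs]. At a
    critical [s] both branches are in the list. *)
Lemma orbit_leaf c n s o eta : (forall i, `|c i - cs i| < del) ->
  is_orbit c o -> eta <= del -> (o 0%N).1 = s.1 -> `|(o 0%N).2 - s.2| <= eta ->
  exists2 e, e \in leaves n s & e.1 = (o n).1 /\ `|(o n).2 - e.2| <= kap ^+ n * eta.
Proof.
move=> ccs; elim: n s o eta => [|n IH] s o eta oo ed o1 o2.
  by exists s; rewrite ?inE// expr0 mul1r.
have [b ab o1E] := oo 0%N.
have [m1 m2] := move_close b o1.
have eta0 : 0 <= eta by apply: le_trans o2.
have [||||e eL [e1 e2]] := IH (move b s) (fun t => o (1 + t)%N) (kap * eta).
- exact: orbit_shift.
- by apply: le_trans ed; rewrite ler_piMl// ltW.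
- by rewrite addn0 o1E.
- by rewrite addn0 o1E; apply: (le_trans m2); rewrite ler_wpM2l.
exists e; last by split=> //; rewrite exprSr -mulrA.
rewrite /=; case: ifPn => [_|ncrit].
  by rewrite mem_cat; move: eL; case: (b) => ->; rewrite ?orbT.
suff -> : (cs s.1 < s.2) = b by [].
move: ncrit ab; rewrite /critical -ltNge lter_normr /allowed o1 => /orP ncrit.
have := ccs s.1; rewrite ltr_norml => /andP[c1 c2].
move: o2; rewrite ler_norml => /andP[p2 p3].
case: (b) => ab; first by case: ncrit => ncrit; lra.
by apply/negbTE; rewrite -leNgt; case: ncrit => ncrit; lra.
Qed.

Lemma gapped_critical s w : gapped -> critical s -> (0 < size w <= K)%N ->
  ~~ critical (run w s).
Proof.
move=> gap cr wK; rewrite /critical -ltNge.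
have [r1 r2] := @run_close w s (s.1, cs s.1) erefl.
have := gap w s.1 wK; rewrite -r1.
have {}r2 : `|(run w s).2 - (run w (s.1, cs s.1)).2| <= 2 * del.
  apply: (le_trans r2); apply: le_trans cr.
  by rewrite ler_piMl// exprn_ile1//; exact: ltW.
rewrite distrC in r2.
have := ler_distD (run w s).2 (run w (s.1, cs s.1)).2 (cs (run w s).1).
lra.
Qed.

Lemma leaves_noncritical m s :
  (forall w, (size w < m)%N -> ~~ critical (run w s)) -> size (leaves m s) = 1%N.
Proof.
elim: m s => //= m IH s nc; rewrite (negbTE (nc [::] _))//.
by apply: IH => w wm; exact: (nc ((cs s.1 < s.2) :: w) wm).
Qed.

(** After a fork the next [K] states are noncritical, so no second fork fits into [K] steps. *)
Lemma size_leaves_le2 m s : gapped -> (m <= K)%N -> (size (leaves m s) <= 2)%N.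
Proof.
move=> gap; elim: m s => //= m IH s mK; case: ifPn => cr; last exact/IH/ltnW.
have one b : size (leaves m (move b s)) = 1%N.
  apply: leaves_noncritical => w wm.
  by apply: (@gapped_critical s (b :: w)) => //=; apply: ltn_trans mK.
by rewrite size_cat !one.
Qed.

Lemma leaves_add m n s :
  leaves (m + n) s = flatten [seq leaves n e | e <- leaves m s].
Proof.
elim: m s => [|m IH] s /=; first by rewrite cats0.
by case: ifP => _; rewrite !IH// map_cat flatten_cat.
Qed.

Lemma size_leaves q s : gapped -> (size (leaves (q * K) s) <= 2 ^ q)%N.
Proof.
move=> gap; elim: q s => //= q IH s; rewrite mulSn leaves_add.
have := size_leaves_le2 s gap (leqnn K).
case: (leaves K s) => [|e1 [|e2 [|//]]] _ /=; rewrite ?cats0 ?expn_gt0//.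
  by rewrite (leq_trans (IH _))// leq_exp2l.
by rewrite size_cat expnS mul2n -addnn leq_add.
Qed.

(** If [c] does not avoid its cuts, some orbit comes within [eta] of a cut after more than [q * K]
    steps. Its state is then within [eta] of a leaf grown from a net point, so one coordinate of [c]
    is within [2 * eta] of that leaf. There are [2 ^ q] leaves per net point, and [eta] carries the
    factor [kap ^+ (q * K)]. *)
Lemma non_avoiding_content0 (M : R) : 0 < M -> 0 < H -> 2 * kap ^+ K <= 1 / 2 -> gapped ->
  content0 [set c | [/\ forall i, `|c i - cs i| < del, forall i, `|c i| <= M
                      & ~ avoids c]].
Proof.
move=> M0 H0 kK gap eps e0.
pose n := Num.truncn (2 * H / del).
have nd : 2 * H / n.+1%:R <= del.
  rewrite ler_pdivrMr ?ltr0Sn// -ler_pdivrMl// mulrC.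
  by apply/ltW; exact: truncnS_gt.
pose x (t : 'I_n.+2) : R := 2 * H / n.+1%:R * t%:R - H.
pose C : R := (#|I| * n.+2)%:R * (4 * del * (2 * M) ^+ #|I|.-1).
have C0 : 0 <= C.
  by apply: mulr_ge0 => //; apply: mulr_ge0; rewrite ?exprn_ge0// mulr_ge0// ltW.
have [q qC] : exists q, C * (1 / 2) ^+ q <= eps by apply: geometric_small => //; lra.
have qC' : C * (2 * kap ^+ K) ^+ q <= eps.
  apply: le_trans qC; rewrite ler_wpM2l//; apply: lerXn2r => //; rewrite nnegrE; last lra.
  by rewrite mulr_ge0// exprn_ge0.
pose T := (I * 'I_n.+2 * 'I_(2 ^ q))%type.
(* When there are fewer than [2 ^ q] leaves, the surplus indices give the default [(t.1.1, 0)],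
   which merely adds boxes. *)
pose lf (t : T) := nth (t.1.1, 0) (leaves (q * K) (t.1.1, x t.1.2)) t.2.
pose eta := kap ^+ (q * K) * del.
have eta0 : 0 < eta by rewrite mulr_gt0// exprn_gt0//; case/andP: kap01.
exists T, (fun t l => if l == (lf t).1 then (lf t).2 else 0),
  (fun t l => if l == (lf t).1 then 2 * eta else M); split.
- by move=> t l; case: ifP => _; lra.
- move=> c [ccs cM nav].
  (* The inequality [q * K < t] is strict so that the state [q * K] steps earlier is already an
     image, hence bounded by [H]. *)
  have [y [yo [t tq ytc]]] : exists o, is_orbit c o /\
      exists2 t, (q * K < t)%N & `|(o t).2 - c (o t).1| < eta.
    apply: contrapT => no; apply: nav; exists (q * K).+1; exists eta => // o oo t.
    rewrite leNgt; apply/negP => lt_eta; apply: no; exists o; split => //.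
    by exists ((q * K).+1 + t)%N => //; exact: leq_addr.
  pose y' k := y (t - q * K + k)%N.
  have y'b : `|(y' 0%N).2| <= H.
    by rewrite /y' addn0; apply: (orbit_bounded yo); rewrite subn_gt0.
  have [k kP] := uniform_net n H0 y'b.
  have [||||e eL [e1 e2]] := @orbit_leaf c (q * K) ((y' 0%N).1, x k) y' del ccs.
  + exact: orbit_shift.
  + by [].
  + by [].
  + by apply: le_trans nd.
  have y'q : y' (q * K)%N = y t by rewrite /y' subnK// ltnW.
  rewrite y'q -/eta in e1 e2.
  have idx : (index e (leaves (q * K) ((y' 0%N).1, x k)) < 2 ^ q)%N.
    by apply: leq_trans (size_leaves q ((y' 0%N).1, x k) gap); rewrite index_mem.
  exists ((y' 0%N).1, k, Ordinal idx) => l.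
  rewrite /lf /= nth_index//; case: eqP => [->|_]; last by rewrite subr0.
  rewrite e1 distrC; have := ler_distD (y t).2 e.2 (c (y t).1).
  by rewrite distrC in e2; lra.
- have vol (j : I) : \prod_l (2 * (if l == j then 2 * eta else M)) =
      4 * eta * (2 * M) ^+ #|I|.-1.
    under eq_bigr => l _ do rewrite fun_if.
    by rewrite prod_if; congr (_ * _); ring.
  rewrite /=; under eq_bigr => t _ do rewrite vol.
  rewrite sumr_const !card_prod !card_ord -[leLHS]mulr_natl natrM natrX.
  apply: le_trans qC'; rewrite /C /eta [(2 * kap ^+ K) ^+ q]exprMn -exprM.
  rewrite [(K * q)%N]mulnC.
  by rewrite le_eqVlt; apply/orP; left; apply/eqP; ring.
Qed.

End Tree.

(** Finitely many words have length at most [K], so their images of cuts miss all cuts by some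
    [eta > 6 * del]. Passing to [cs] displaces image and cut by less than [del] each, which leaves
    more than [4 * del]. Rational [cs] and reciprocal integers [del] form a countable family. *)
Lemma exists_gapped c K :
  (forall w i, (0 < size w <= K)%N ->
    (run w (i, c i)).2 != c (run w (i, c i)).1) ->
  exists (cs : {ffun I -> rat}) (m : nat),
    (forall i, `|c i - ratr (cs i)| < m.+1%:R^-1) /\
    gapped (fun i => ratr (cs i)) m.+1%:R^-1 K.
Proof.
move=> noconn.
(* The empty word leaves each cut in place, at distance 0; the value 1 keeps [F] positive. *)
pose F (wi : K.-bseq bool * I) : R := let s := run wi.1 (wi.2, c wi.2) in
  if nilp wi.1 then 1 else `|s.2 - c s.1|.
have [|eta eta0 etaF] := @finite_lower_bound R _ F.
  move=> [w i]; rewrite /F /=; case: ifPn => // w0.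
  by rewrite normr_gt0 subr_eq0 noconn// lt0n w0 size_bseq.
have [m mE] : exists m : nat, 6 * m.+1%:R^-1 < eta.
  exists (Num.truncn (6 / eta)); rewrite ltr_pdivrMr ?ltr0Sn// -ltr_pdivrMl// mulrC.
  exact: truncnS_gt.
set del := m.+1%:R^-1 in mE *.
have del0 : 0 < del by rewrite invr_gt0 ltr0Sn.
have /choice[cs csP] i : exists r : rat, `|c i - ratr r| < del.
  have [|r] := @rat_in_itvoo R (c i - del) (c i + del); first lra.
  by rewrite in_itv/= => /andP[r1 r2]; exists r; rewrite ltr_norml; lra.
exists [ffun i => cs i], m; rewrite -/del; split => [i|w i wK].
  by rewrite ffunE.
have /andP[w0 wle] := wK.
have := etaF (Bseq wle, i); rewrite /F /= /nilp eqn0Ngt w0 /=.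
rewrite !ffunE; set x := ratr (cs i).
have [r1 r2] := @run_close w (i, c i) (i, x) erefl.
rewrite -r1; set j := (run _ _).1.
have h1 := csP j.
have h2 : `|(run w (i, c i)).2 - (run w (i, x)).2| < del.
  apply: (le_lt_trans r2); apply: le_lt_trans (csP i) => /=.
  by rewrite ler_piMl// exprn_ile1//; exact: ltW.
move: h1 h2; set y := (run w (i, c i)).2; set z := (run w (i, x)).2.
have := ler_distD z y (c j); have := ler_distD (ratr (cs j)) z (c j).
rewrite [`|ratr _ - c j|]distrC.
lra.
Qed.

(** With [K] fixed so that contraction beats the doubling of leaves, each [c] either has a cut
    connection of length at most [K] or lies near a gapped rational reference point. Both cases
    range over countable families. *)
Lemma avoids_generic (M : R) : 0 < M -> 0 < H ->
  sigma_content0 [set c | (forall i, `|c i| <= M) /\ ~ avoids c].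
Proof.
move=> M0 H0.
have [K kK] : exists K, 2 * kap ^+ K <= 1 / 2.
  by apply: geometric_small; [rewrite kap0 | lra].
pose F (t : (seq bool * I) + ({ffun I -> rat} * nat)) : set (I -> R) :=
  match t with
  | inl (w, i) => [set c | w != [::] /\ cut_connection M w i c]
  | inr (cs, m) => let cs' i := ratr (cs i) in [set c | gapped cs' m.+1%:R^-1 K /\
      [/\ forall i, `|c i - cs' i| < m.+1%:R^-1, forall i, `|c i| <= M & ~ avoids c]]
  end.
(* Conditions not involving [c] are put inside the sets, which become empty when they fail; the
   index type needs no restriction. *)
have guard (P : Prop) (A : set (I -> R)) :
    (P -> content0 A) -> content0 [set c | P /\ A c].
  move=> PA eps e0; have [p|np] := pselect P.
    have [T [a [r [r0 Ac v]]]] := PA p eps e0; exists T, a, r; split => //.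
    by move=> c [_ /Ac].
  have [T [a [r [r0 _ v]]]] := @content0_set0 R I eps e0.
  by exists T, a, r; split => // c [].
apply: (@sigma_content0_countable R I _ F).
  case=> [[w i]|[cs m]]; apply: guard; first exact: cut_connection_content0.
  by apply: non_avoiding_content0; rewrite ?invr_gt0 ?ltr0Sn.
move=> c [cM nav].
have [[w [i [wK cw]]]|nocon] := pselect (exists w i, (0 < size w <= K)%N /\
    (run w (i, c i)).2 = c (run w (i, c i)).1).
  by exists (inl (w, i)); split => //; case: (w) wK.
have [w i wK|cs [m [h1 h2]]] := @exists_gapped c K.
  by apply/eqP => cw; apply: nocon; exists w, i.
by exists (inr (cs, m)).
Qed.

End Dynamics.

(** * Logit coordinates and Lebesgue measure *)

Section Logit.
Variable R : realType.
Implicit Types (x y h : R).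

Definition logit x := ln x - ln (1 - x).

Definition expit h := expR h / (1 + expR h).

Lemma expit_itv h : 0 < expit h < 1.
Proof.
have e0 := expR_gt0 h; apply/andP; split; first by apply: divr_gt0; lra.
by rewrite ltr_pdivrMr; lra.
Qed.

Lemma onem_expit h : 1 - expit h = (1 + expR h)^-1.
Proof. by have e0 := expR_gt0 h; rewrite /expit; field; lra. Qed.

Lemma ler_expit h h' : (expit h <= expit h') = (h <= h').
Proof.
have e0 := expR_gt0 h; have e0' := expR_gt0 h'.
rewrite -[LHS]lerN2 -(lerD2l 1) !onem_expit lef_pV2 ?posrE; [|lra|lra].
by rewrite lerD2l ler_expR.
Qed.

Lemma logitK x : 0 < x < 1 -> expit (logit x) = x.
Proof.
move=> /andP[x0 x1]; rewrite /expit /logit expRD expRN !lnK ?posrE//; last lra.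
by field; lra.
Qed.

Lemma expitK h : logit (expit h) = h.
Proof.
have e0 := expR_gt0 h; have e1 : 0 < 1 + expR h by lra.
by rewrite /logit onem_expit /expit ln_div ?posrE// expRK lnV ?posrE//; ring.
Qed.

Lemma ln_le_subr1 x : 0 < x -> ln x <= x - 1.
Proof.
by move=> x0; have := @le_ln1Dx R (x - 1); rewrite [1 + _]addrC subrK; apply; lra.
Qed.

(** For [x <= y], already [ln y - ln x >= 1 - x / y >= y - x], and the term in [1 - x] only adds to
    this. *)
Lemma logit_expand x y : 0 < x < 1 -> 0 < y < 1 -> `|x - y| <= `|logit x - logit y|.
Proof.
wlog xy : x y / x <= y.
  move=> wl x01 y01; have [|yx] := leP x y; first by move/wl; exact.
  by rewrite distrC [leRHS]distrC; apply: wl => //; exact: ltW.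
move=> /andP[x0 x1] /andP[y0 y1]; rewrite distrC [leRHS]distrC ger0_norm; last lra.
apply: le_trans (ler_norm _); rewrite /logit.
have h1 : ln (1 - y) <= ln (1 - x) by rewrite ler_ln ?posrE; lra.
have h2 := @ln_le_subr1 (x / y) (divr_gt0 x0 y0).
rewrite ln_div ?posrE// in h2.
have h3 : y - x <= 1 - x / y.
  have -> : 1 - x / y = (y - x) / y by field; lra.
  by rewrite ler_pdivlMr//; nra.
lra.
Qed.

Lemma expit_contract h h' : `|expit h - expit h'| <= `|h - h'|.
Proof.
by have := logit_expand (expit_itv h) (expit_itv h'); rewrite !expitK.
Qed.

End Logit.

Section Negligible.
Variable R : realType.
Local Notation mu :=
  ((@lebesgue_measure R \x @lebesgue_measure R) \x @lebesgue_measure R)%E.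

Definition brick (a r : 'I_3 -> R) : set ((R * R) * R) :=
  let J i := `[a i - r i, a i + r i]%classic in
  (J ord0 `*` J (inord 1)) `*` J (inord 2).

Lemma measurable_brick a r : measurable (brick a r).
Proof. by apply: measurableX => //; apply: measurableX. Qed.

Lemma lebesgue3_brick (a r : 'I_3 -> R) : (forall i, 0 <= r i) ->
  mu (brick a r) = (\prod_i (2 * r i))%:E.
Proof.
move=> r0; rewrite product_measure1E//; last exact: measurableX.
rewrite /= product_measure1E//.
have len i : lebesgue_measure (`[a i - r i, a i + r i]%classic : set R) = (2 * r i)%:E.
  rewrite lebesgue_measure_itv/= lte_fin; have := r0 i; case: ltP => h1 h2.
    by rewrite -EFinD; congr EFin; lra.
  by congr EFin; lra.
transitivity ((2 * r ord0)%:E * (2 * r (inord 1))%:E * (2 * r (inord 2))%:E)%E.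
  by congr (_ * _ * _)%E; exact: len.
rewrite !big_ord_recl big_ord0 mulr1 mulrA -!EFinM.
by congr (_ * (2 * r _) * (2 * r _))%:E; apply/val_inj; rewrite /= inordK.
Qed.

Lemma mem_brick (p : (R * R) * R) (a r : 'I_3 -> R) :
  (forall i, `|dvec p i - a i| <= r i) -> brick a r p.
Proof.
move=> pa; have inJ i : dvec p i \in `[a i - r i, a i + r i].
  by rewrite in_itv/=; have := pa i; rewrite ler_norml; lra.
split; [split|]; rewrite /=.
- exact: (inJ ord0).
- by have := inJ (inord 1); rewrite /dvec /= inordK.
- by have := inJ (inord 2); rewrite /dvec /= inordK.
Qed.

(** Since [expit] is 1-Lipschitz, a box in logit coordinates is mapped into a brick with the same
    half-widths. Intersecting the covers of volume at most [n.+1%:R^-1] gives a measurable null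
    set. *)
Lemma content0_negligible (A : set ('I_3 -> R)) : content0 A ->
  mu.-negligible [set p | (forall i, 0 < dvec p i < 1) /\ A (fun i => logit (dvec p i))].
Proof.
move=> A0.
have cover (n : nat) : exists S : set ((R * R) * R), [/\ measurable S,
    (mu S <= (n.+1%:R^-1)%:E)%E &
    [set p | (forall i, 0 < dvec p i < 1) /\ A (fun i => logit (dvec p i))] `<=` S].
  have [|T [a [r [r0 Ac vol]]]] := A0 n.+1%:R^-1; first by rewrite invr_gt0 ltr0Sn.
  pose B t := brick (fun i => expit (a t i)) (r t).
  exists (\big[setU/set0]_t B t); split.
  - by apply: bigsetU_measurable => t _; exact: measurable_brick.
  - apply: (@le_trans _ _ (\sum_t \prod_i (2 * r t i))%:E); last by rewrite lee_fin.
    suff [] : measurable (\big[setU/set0]_t B t) /\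
      (mu (\big[setU/set0]_t B t) <= (\sum_t \prod_i (2 * r t i))%:E)%E by [].
    elim/big_rec2: _ => [|t v S _ [mS Sv]]; first by rewrite measure0.
    have mB := measurable_brick (fun i => expit (a t i)) (r t).
    split; first exact: measurableU.
    apply: (le_trans (@measureU2 _ _ R mu _ _ mB mS)).
    rewrite EFinD; apply: leeD => //.
    by rewrite -(lebesgue3_brick (fun i => expit (a t i)) (r0 t)).
  - move=> p [p01 /Ac[t pt]]; rewrite (bigD1 t)//=; left; apply: mem_brick => i.
    apply: le_trans (pt i); rewrite -[dvec p i in leLHS]logitK//.
    exact: expit_contract.
have /choice[S SP] := cover; exists (\bigcap_n S n); split.
- by apply: bigcapT_measurable => n; have [] := SP n.
- apply/eqP; rewrite eq_le measure_ge0 andbT; apply/lee_addgt0Pr => e e0.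
  have [n ne] : exists n : nat, n.+1%:R^-1 <= e.
    exists (Num.truncn e^-1); rewrite -[leRHS]invrK lef_pV2 ?posrE ?invr_gt0 ?ltr0Sn//.
    exact/ltW/truncnS_gt.
  rewrite add0e; have [mS Sn _] := SP n.
  apply: (@le_trans _ _ (mu (S n))); last by apply: (le_trans Sn); rewrite lee_fin.
  apply: le_measure; rewrite ?inE//; last exact: bigcap_inf.
  by apply: bigcapT_measurable => k; have [] := SP k.
- by move=> p Ap n _; have [_ _] := SP n; exact.
Qed.

Lemma sigma_content0_negligible (A : set ('I_3 -> R)) : sigma_content0 A ->
  mu.-negligible [set p | (forall i, 0 < dvec p i < 1) /\ A (fun i => logit (dvec p i))].
Proof.
move=> [F [F0 AF]].
apply: negligibleS (negligible_bigcup (fun n => content0_negligible (F0 n))).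
by move=> p [p01 /AF[n _ Fn]]; exists n.
Qed.

End Negligible.

(** * The triangle process *)

Section Branch.
Variables (R : realType) (M : R).
Implicit Types (a b B h : R).

(** In odds [x / (1 - x)] a branch is [y |-> a / (B * y + b)]; this is its logarithmic form, with
    the argument capped at [M]. *)
Definition log_branch a b B h := ln a - ln (B * expR (Num.min h M) + b).

(** The slope of [h |-> ln (B * expR h + b)] at [h = M], which is its largest value for [h <= M]. *)
Definition branch_rate b B := B * expR M / (B * expR M + b).

(** By convexity of [h |-> ln (B * expR h + b)], a chord is at most as steep as the tangent at its
    right end [u], whose slope [t] is at most the slope at the cap. *)
Lemma log_branch_lip a b B h h' : 0 < b -> 0 < B ->
  `|log_branch a b B h - log_branch a b B h'| <= branch_rate b B * `|h - h'|.
Proof.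
move=> b0 B0; wlog hh : h h' / h' <= h.
  move=> wl; have [/wl//|/ltW/wl] := leP h' h.
  by rewrite distrC [`|h' - h|]distrC.
have sub3 (A X Y : R) : A - X - (A - Y) = Y - X by ring.
rewrite distrC /log_branch sub3.
pose u := Num.min h M; pose u' := Num.min h' M.
have uu : u' <= u by rewrite /u /u'; case: (ltP h' M); case: (ltP h M); lra.
have uh : u - u' <= h - h' by rewrite /u /u'; case: (ltP h' M); case: (ltP h M); lra.
have uM : u <= M by rewrite ge_min lexx orbT.
rewrite -/u -/u' (@ger0_norm _ (h - h')); last lra.
have E0 := expR_gt0 u; have E'0 := expR_gt0 u'.
have EE : expR u' <= expR u by rewrite ler_expR.
have EM : expR u <= expR M by rewrite ler_expR.
have be (x : R) : 0 < x -> 0 < B * x + b by move=> ?; rewrite addr_gt0// mulr_gt0.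
have bE := be _ E0; have bE' := be _ E'0; have bM := be _ (expR_gt0 M).
rewrite ger0_norm; last by rewrite subr_ge0 ler_ln ?posrE// lerD2r ler_pM2l.
pose t := B * expR u / (B * expR u + b).
have t_rate : t <= branch_rate b B.
  rewrite /t /branch_rate ler_pdivrMr// mulrAC ler_pdivlMr//.
  have : b * (B * expR u) <= b * (B * expR M) by rewrite ler_pM2l// ler_pM2l.
  lra.
have t0 : 0 < t by rewrite divr_gt0// mulr_gt0.
apply: (@le_trans _ _ (t * (u - u'))); last by apply: ler_pM => //; lra.
(* Jensen for [ln], obtained by comparing [ln] with its tangent at the mean. *)
pose w := (B * expR u' + b) / (B * expR u + b).
have w0 : 0 < w by apply: divr_gt0.
have -> : ln (B * expR u + b) - ln (B * expR u' + b) = - ln w.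
  by rewrite /w ln_div ?posrE//; ring.
have h1 : u' - u - ln w <= expR u' / expR u / w - 1.
  have := @ln_le_subr1 R (expR u' / expR u / w); rewrite !ln_div ?posrE ?divr_gt0//.
  by rewrite !expRK; exact.
have h2 : - ln w <= w^-1 - 1.
  by rewrite -lnV ?posrE//; apply: ln_le_subr1; rewrite invr_gt0.
have -> : u - u' = - (u' - u) by ring.
have t1 : 0 < 1 - t.
  have -> : 1 - t = b / (B * expR u + b) by rewrite /t; field; lra.
  exact: divr_gt0.
have h1' : t * (u' - u - ln w) <= t * (expR u' / expR u / w - 1) by rewrite ler_pM2l.
have h2' : (1 - t) * - ln w <= (1 - t) * (w^-1 - 1) by rewrite ler_pM2l.
(* The weights [t] and [1 - t] make the two tangent bounds cancel, because
   [t * (expR u' / expR u) + (1 - t) = w]. *)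
have e : t * (expR u' / expR u / w - 1) + (1 - t) * (w^-1 - 1) = 0.
  rewrite /t /w; field; lra.
lra.
Qed.

Lemma log_branch_bounded a b B h : 0 < b -> 0 < B ->
  `|log_branch a b B h| <= `|ln a| + `|ln b| + `|ln (B * expR M + b)|.
Proof.
move=> b0 B0; rewrite /log_branch.
have e0 := expR_gt0 (Num.min h M).
have e1 : expR (Num.min h M) <= expR M by rewrite ler_expR ge_min lexx orbT.
have p1 : 0 < B * expR (Num.min h M) by rewrite mulr_gt0.
have p2 : B * expR (Num.min h M) <= B * expR M by rewrite ler_pM2l.
have h1 : ln b <= ln (B * expR (Num.min h M) + b) by rewrite ler_ln ?posrE; lra.
have h2 : ln (B * expR (Num.min h M) + b) <= ln (B * expR M + b).
  by rewrite ler_ln ?posrE; lra.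
have := ler_norm (ln a); have := ler_norm (- ln a).
have := ler_norm (- ln b); have := ler_norm (ln (B * expR M + b)).
have := normr_ge0 (ln b); have := normr_ge0 (ln (B * expR M + b)).
by rewrite !normrN ler_norml; lra.
Qed.

Lemma branch_rate_itv b B : 0 < b -> 0 < B -> 0 < branch_rate b B < 1.
Proof.
move=> b0 B0; have e0 : 0 < B * expR M by rewrite mulr_gt0// expR_gt0.
rewrite /branch_rate; apply/andP; split; first by apply: divr_gt0; lra.
by rewrite ltr_pdivrMr; lra.
Qed.

Lemma expit_log_branch a b B h : 0 < a -> 0 < b -> 0 < B -> h <= M ->
  expit (log_branch a b B h) = a / (a + B * expR h + b).
Proof.
move=> a0 b0 B0 hM; have e0 := expR_gt0 h.
have p1 : 0 < B * expR h by rewrite mulr_gt0.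
rewrite /expit /log_branch (min_idPl hM) expRD expRN !lnK ?posrE//; last lra.
by field; lra.
Qed.

Lemma expitN h : expit (- h) = 1 - expit h :> R.
Proof. by have e0 := expR_gt0 h; rewrite onem_expit /expit expRN; field; lra. Qed.

End Branch.

(** * Cyclic indices and points on the sides of the triangle *)

Section Ord3.
Implicit Types i l : 'I_3.

Lemma val_nxt i : nxt i = ((i + 1) %% 3)%N :> nat.
Proof. by rewrite /nxt inordK// ltn_pmod. Qed.

Lemma nxtK i : nxt (nxt (nxt i)) = i.
Proof. by apply: val_inj; rewrite /= !val_nxt; case: i => [[|[|[|]]]]. Qed.

Lemma nxt_neq i : (nxt i == i) = false.
Proof. by rewrite -val_eqE /= val_nxt; case: i => [[|[|[|]]]]. Qed.

Lemma nxt2_neq i : (nxt (nxt i) == i) = false.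
Proof. by rewrite -val_eqE /= !val_nxt; case: i => [[|[|[|]]]]. Qed.

Lemma ord3_cases i l : [\/ l = i, l = nxt i | l = nxt (nxt i)].
Proof.
have [->|li] := eqVneq l i; first by constructor 1.
have [->|lj] := eqVneq l (nxt i); first by constructor 2.
constructor 3; apply: val_inj; move: li lj; rewrite /= -!val_eqE /= !val_nxt.
by case: i => [[|[|[|]]]] //; case: l => [[|[|[|]]]].
Qed.

Lemma sum3 (R : realType) i (F : 'I_3 -> R) :
  \sum_l F l = F i + F (nxt i) + F (nxt (nxt i)).
Proof.
rewrite (bigD1 i)// (bigD1 (nxt i)) ?nxt_neq//= (bigD1 (nxt (nxt i)))/=; last first.
  by rewrite nxt2_neq nxt_neq.
rewrite big1 => [|l]; first by rewrite addr0 addrA.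
by case: (ord3_cases i l) => ->; rewrite eqxx ?andbF.
Qed.

End Ord3.

Section Point.
Variable R : realType.
Implicit Types (i j l : 'I_3) (x y : R).

Lemma ptE i x : [/\ pt i x ord0 i = 0, pt i x ord0 (nxt i) = 1 - x
  & pt i x ord0 (nxt (nxt i)) = x].
Proof.
split; rewrite !mxE ?eqxx ?nxt_neq.
- by rewrite ![i == _]eq_sym nxt_neq nxt2_neq; ring.
- by rewrite [nxt i == _]eq_sym nxt_neq; ring.
- by ring.
Qed.

Lemma pt_ext i x (z : 'rV[R]_3) : z ord0 i = 0 -> z ord0 (nxt i) = 1 - x ->
  z ord0 (nxt (nxt i)) = x -> z = pt i x.
Proof.
have [p0 p1 p2] := ptE i x => z0 z1 z2; apply/rowP => l.
by case: (ord3_cases i l) => ->; rewrite (z0, z1, z2) (p0, p1, p2).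
Qed.

Lemma pt_inj i j x y : 0 < x < 1 -> pt i x = pt j y -> i = j /\ x = y.
Proof.
move=> /andP[x0 x1] e; have [p0 p1 p2] := ptE i x; have [q0 q1 q2] := ptE j y.
have ij : j = i.
  by case: (ord3_cases i j) => // jE; exfalso; move: q0;
    rewrite -e jE (p1, p2); lra.
by split=> //; rewrite -p2 e -ij.
Qed.

Lemma side_pt i x : 0 < x < 1 -> side (pt i x) = i.
Proof.
move=> /andP[x0 x1]; have [p0 p1 p2] := ptE i x; rewrite /side.
case: pickP => [l|/(_ i)]; last by rewrite p0 eqxx.
by case: (ord3_cases i l) => -> //= /eqP; rewrite (p1, p2) => q; exfalso; lra.
Qed.

Lemma inA0_pt i x : 0 <= x <= 1 -> inA0 (pt i x).
Proof.
move=> /andP[x0 x1]; have [p0 p1 p2] := ptE i x; exists i; split; last split=> //.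
  by rewrite (sum3 i) p0 p1 p2; ring.
by move=> l; case: (ord3_cases i l) => ->; rewrite (p0, p1, p2); lra.
Qed.

Lemma dist1_pt i x y : dist1 (pt i x) (pt i y) = `|x - y|.
Proof.
have [p0 p1 p2] := ptE i x; have [q0 q1 q2] := ptE i y.
rewrite /dist1 (sum3 i) p0 p1 p2 q0 q1 q2.
rewrite (_ : _ + _ = 2 * (x - y) ^+ 2); last by ring.
rewrite sqrtrM// sqrtr_sqr mulrAC divff ?mul1r//.
Qed.

(** The image consists of the open sides only; corners have no finite logit. *)
Definition embed (s : 'I_3 * R) : 'rV[R]_3 := pt s.1 (expit s.2).

Definition unembed (z : 'rV[R]_3) : 'I_3 * R :=
  let i := side z in (i, logit (z ord0 (nxt (nxt i)))).

Lemma embedK : cancel embed unembed.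
Proof.
move=> [i h]; rewrite /unembed /embed /= side_pt ?expit_itv//.
by have [_ _ ->] := ptE i (expit h); rewrite expitK.
Qed.

Lemma side_embed s : side (embed s) = s.1.
Proof. by rewrite side_pt// expit_itv. Qed.

End Point.

(** * Conjugacy of the triangle process with a piecewise contraction *)

Section Triangle.
Variables (R : realType) (lam mu : 'I_3 -> R).
Hypothesis lam_gt0 : forall i, 0 < lam i.
Hypothesis mu_gt0 : forall i, 0 < mu i.
Hypothesis lam_lt_mu : forall i, lam i < mu i.
Local Notation f := (Defs.fmap lam mu).
Implicit Types (i j k : 'I_3) (x h : R) (s : 'I_3 * R).

Let net j := mu j - lam j.

Let net_gt0 j : 0 < net j. Proof. by rewrite subr_gt0. Qed.

Lemma fmapE i j z l : f j z ord0 l = if l == j then 0 else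
  (net j * z ord0 l + lam l * z ord0 j) /
    (net j + (lam i + lam (nxt i) + lam (nxt (nxt i)) - mu j) * z ord0 j).
Proof.
rewrite mxE; case: ifP => // _; rewrite /theta (sum3 i) mulrBr mulr1.
by rewrite [mu j * (_ / _)]mulrCA divff ?mulr1// gt_eqF.
Qed.

(** The common shape of the denominators of [f], rewritten as a combination of [x] and [1 - x] with
    positive coefficients. *)
Let weight (b c k : R) x := b * x + c * (1 - x) + k * (1 - x).

Lemma weight_gt0 (b c k x : R) : 0 < b -> 0 < c -> 0 < k -> 0 <= x <= 1 ->
  0 < weight b c k x.
Proof.
move=> b0 c0 k0 /andP[x0 x1]; rewrite /weight.
have [x12|x12] := ltP x (1 / 2).
  have h1 : 0 <= b * x by rewrite mulr_ge0// ltW.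
  have h2 : 0 < c * (1 - x) by rewrite mulr_gt0//; lra.
  have h3 : 0 < k * (1 - x) by rewrite mulr_gt0//; lra.
  lra.
have h1 : 0 < b * x by rewrite mulr_gt0//; lra.
have h2 : 0 <= c * (1 - x) by apply: mulr_ge0; [exact: ltW | lra].
have h3 : 0 <= k * (1 - x) by apply: mulr_ge0; [exact: ltW | lra].
lra.
Qed.

Definition serve_next i x := lam i * (1 - x) /
  weight (net (nxt i)) (lam i) (lam (nxt (nxt i))) x.

(** Written as the mirror image of [serve_next] under [x |-> 1 - x], which in logit coordinates is a
    change of sign. *)
Definition serve_last i x := 1 - lam i * x /
  weight (net (nxt (nxt i))) (lam i) (lam (nxt i)) (1 - x).

Lemma serve_nextE i x : 0 <= x <= 1 ->
  f (nxt i) (pt i x) = pt (nxt i) (serve_next i x).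
Proof.
move=> x01; have [p0 p1 p2] := ptE i x.
have w0 := weight_gt0 (net_gt0 (nxt i)) (lam_gt0 i) (lam_gt0 (nxt (nxt i))) x01.
have den : net (nxt i) + (lam i + lam (nxt i) + lam (nxt (nxt i)) - mu (nxt i)) *
    (1 - x) = weight (net (nxt i)) (lam i) (lam (nxt (nxt i))) x.
  by rewrite /weight /net; ring.
apply: pt_ext; rewrite ?nxtK (fmapE i) ?eqxx ?nxt_neq 1?[i == _]eq_sym ?nxt_neq//.
- rewrite p1 p2 den /serve_next; move: w0; rewrite /weight => w0; field; lra.
- by rewrite p0 p1 den mulr0 add0r.
Qed.

Lemma serve_lastE i x : 0 <= x <= 1 ->
  f (nxt (nxt i)) (pt i x) = pt (nxt (nxt i)) (serve_last i x).
Proof.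
move=> x01; have [p0 p1 p2] := ptE i x.
have x01' : 0 <= 1 - x <= 1 by lra.
have w0 := weight_gt0 (net_gt0 (nxt (nxt i))) (lam_gt0 i) (lam_gt0 (nxt i)) x01'.
have den : net (nxt (nxt i)) + (lam i + lam (nxt i) + lam (nxt (nxt i)) -
    mu (nxt (nxt i))) * x =
    weight (net (nxt (nxt i))) (lam i) (lam (nxt i)) (1 - x).
  by rewrite /weight /net; ring.
apply: pt_ext; rewrite ?nxtK (fmapE i) ?eqxx//.
- by rewrite [i == _]eq_sym nxt2_neq p0 p2 den mulr0 add0r /serve_last; ring.
- rewrite [nxt i == _]eq_sym nxt_neq p1 p2 den /serve_last.
  move: w0; rewrite /weight => w0; field; lra.
Qed.

(** The image is interior even for the corner [x = 0]. The other corner is excluded, and the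
    switching rule never serves [nxt i] there because [d i < 1]. *)
Lemma serve_next_itv i x : 0 <= x < 1 -> 0 < serve_next i x < 1.
Proof.
move=> /andP[x0 x1]; rewrite /serve_next.
have x01 : 0 <= x <= 1 by lra.
have w0 := weight_gt0 (net_gt0 (nxt i)) (lam_gt0 i) (lam_gt0 (nxt (nxt i))) x01.
have h1 : 0 < lam i * (1 - x) by rewrite mulr_gt0//; lra.
have h2 : 0 < lam (nxt (nxt i)) * (1 - x) by rewrite mulr_gt0//; lra.
have h3 : 0 <= net (nxt i) * x by rewrite mulr_ge0// ltW.
apply/andP; split; first exact: divr_gt0.
by rewrite ltr_pdivrMr// /weight; lra.
Qed.

Lemma serve_last_itv i x : 0 < x <= 1 -> 0 < serve_last i x < 1.
Proof.
move=> /andP[x0 x1]; rewrite /serve_last.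
have x01 : 0 <= 1 - x <= 1 by lra.
have w0 := weight_gt0 (net_gt0 (nxt (nxt i))) (lam_gt0 i) (lam_gt0 (nxt i)) x01.
have h1 : 0 < lam i * x by rewrite mulr_gt0.
have h2 : 0 < lam (nxt i) * x by rewrite mulr_gt0.
have h3 : 0 <= net (nxt (nxt i)) * (1 - x) by apply: mulr_ge0; [exact: ltW | lra].
have h4 : lam i * x / weight (net (nxt (nxt i))) (lam i) (lam (nxt i)) (1 - x) < 1.
  by rewrite ltr_pdivrMr// /weight; lra.
have := divr_gt0 h1 w0; lra.
Qed.

Definition target i (b : bool) := if b then nxt (nxt i) else nxt i.

(* In logit coordinates a branch contracts, but not uniformly on the whole line.
   When all decision points have logit at most [M] in absolute value, each branch
   is applied only on a half-line, outside of which it is made constant. *)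
Definition branch M i (b : bool) h :=
  if b then - log_branch M (lam i) (lam (nxt i)) (net (nxt (nxt i))) (- h)
  else log_branch M (lam i) (lam (nxt (nxt i))) (net (nxt i)) h.

Lemma branch_uniform M : exists kap H : R, [/\ 0 < kap < 1, 0 < H,
  forall i b x y, `|branch M i b x - branch M i b y| <= kap * `|x - y|
  & forall i b x, `|branch M i b x| <= H].
Proof.
pose F1 (t : 'I_3 * 'I_3) : R := 1 - branch_rate M (lam t.1) (net t.2).
have [|e e0 eF1] := @finite_lower_bound R _ F1.
  by move=> t; have := branch_rate_itv M (lam_gt0 t.1) (net_gt0 t.2); rewrite /F1; lra.
pose bd a b B : R := `|ln a| + `|ln b| + `|ln (B * expR M + b)|.
(* Reciprocals turn the common upper bound sought into a common positive lower bound. *)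
pose F2 (t : ('I_3 * 'I_3) * 'I_3) : R :=
  (1 + bd (lam t.1.1) (lam t.1.2) (net t.2))^-1.
have bd0 a b B : 0 <= bd a b B by rewrite /bd !addr_ge0.
have [|e' e'0 eF2] := @finite_lower_bound R _ F2.
  by move=> t; rewrite /F2 invr_gt0 ltr_pwDl.
have e1 : e < 1.
  have := eF1 (ord0, ord0); rewrite /F1 /=.
  by have := branch_rate_itv M (lam_gt0 ord0) (net_gt0 ord0); lra.
have rate i j (x y : R) : branch_rate M (lam i) (net j) * `|x - y| <= (1 - e) * `|x - y|.
  by rewrite ler_wpM2r//; have := eF1 (i, j); rewrite /F1 /=; lra.
have bound i j k : bd (lam i) (lam j) (net k) <= e'^-1.
  have := eF2 ((i, j), k); rewrite /F2 /=; set z := bd _ _ _ => ez.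
  have z1 : 0 < 1 + z by rewrite ltr_pwDl// bd0.
  have : 1 + z <= e'^-1 by rewrite -[leLHS]invrK lef_pV2// posrE invr_gt0.
  lra.
exists (1 - e), e'^-1; split; rewrite ?invr_gt0//; first lra.
- move=> i [] x y; rewrite /branch; last first.
    exact: le_trans (log_branch_lip _ _ _ _ (lam_gt0 _) (net_gt0 _)) (rate _ _ _ _).
  have NN (a b : R) : `|- a - - b| = `|a - b| by rewrite -opprD normrN.
  rewrite NN; apply: le_trans (log_branch_lip _ _ _ _ (lam_gt0 _) (net_gt0 _)) _.
  by rewrite NN; exact: rate.
- move=> i [] x; rewrite /branch ?normrN.
    exact: le_trans (log_branch_bounded _ _ _ (lam_gt0 _) (net_gt0 _)) (bound _ _ _).
  exact: le_trans (log_branch_bounded _ _ _ (lam_gt0 _) (net_gt0 _)) (bound _ _ _).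
Qed.

Variables (d : 'I_3 -> R) (M : R).
Hypothesis d01 : forall i, 0 < d i < 1.
Let c i := logit (d i).
Hypothesis cM : forall i, `|c i| <= M.
Local Notation step := (step target (branch M) c).
Local Notation phi := (phi lam mu d).

Let d_expit i : d i = expit (c i). Proof. by rewrite logitK. Qed.

(** An allowed branch is used only where its argument, [h] or [- h], is at most [M]; there the cap
    is inactive and [branch] is the true map. *)
Lemma serve_embed s b : allowed c s b ->
  f (target s.1 b) (embed s) = embed (move target (branch M) b s).
Proof.
case: s => i h; rewrite /allowed /embed /=.
have x01 := expit_itv h; have x01' : 0 <= expit h <= 1 by lra.
have E0 := expR_gt0 h; have l0 := lam_gt0 i.
have := cM i; rewrite ler_norml => /andP[cM1 cM2].
case: b => hc /=.
  rewrite serve_lastE// expitN expit_log_branch//; last lra.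
  congr pt; rewrite /serve_last /weight; congr (1 - _).
  rewrite !subKr onem_expit /expit expRN.
  have l1 := lam_gt0 (nxt i); have n1 := net_gt0 (nxt (nxt i)).
  have p1 : 0 < expR h * lam i by rewrite mulr_gt0.
  have p2 : 0 < expR h * lam (nxt i) by rewrite mulr_gt0.
  by field; rewrite !lt0r_neq0//; lra.
rewrite serve_nextE// expit_log_branch//; last lra.
congr pt; rewrite /serve_next /weight onem_expit /expit.
have l1 := lam_gt0 (nxt (nxt i)); have n1 := net_gt0 (nxt i).
have p1 : 0 < expR h * net (nxt i) by rewrite mulr_gt0.
by field; rewrite !lt0r_neq0//; lra.
Qed.

(** An interior point determines its side and coordinate, and [expit] is increasing, so the
    switching rule becomes the comparison in [allowed]. *)
Lemma phi_embed s s' : phi (embed s) (embed s') <-> step s s'.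
Proof.
have x01 := expit_itv s.2; have x01' : 0 <= expit s.2 <= 1 by lra.
split=> [[_ [j [[i [x [_ sE sw]]] s'E]]]|[b ab ->]].
  have [i_s xs] := pt_inj x01 sE; subst i x.
  have ex b : allowed c s b -> j = target s.1 b -> step s s'.
    move=> ab jE; exists b => //; apply: (can_inj (@embedK R)).
    by rewrite s'E jE serve_embed.
  case: sw => [[xd jE]|[xd jE]|[xd [jE|jE]]].
  - by apply: (ex false) => //; rewrite /allowed -ler_expit -d_expit ltW.
  - by apply: (ex true) => //; rewrite /allowed -ler_expit -d_expit ltW.
  - by apply: (ex false) => //; rewrite /allowed -ler_expit -d_expit xd.
  - by apply: (ex true) => //; rewrite /allowed -ler_expit -d_expit xd.
split; first exact: inA0_pt.
exists (target s.1 b); rewrite serve_embed//; split => //.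
exists s.1, (expit s.2); split => //.
move: ab; rewrite /allowed /target; case: b; rewrite -ler_expit -d_expit le_eqVlt.
  by case/predU1P => [->|]; [constructor 3; split => //; right | constructor 2].
by case/predU1P => [->|]; [constructor 3; split => //; left | constructor 1].
Qed.

(** Decision points are interior, so each branch is applied away from the corner it would fix on the
    boundary; only an initial state can be a corner. *)
Lemma phi_image z z' : phi z z' -> exists s, z' = embed s.
Proof.
move=> [_ [j [[i [x [/andP[x0 x1] -> sw]]] ->]]].
have x01 : 0 <= x <= 1 by rewrite x0.
have /andP[d0 d1] := d01 i.
have next : x <= d i -> exists s, f (nxt i) (pt i x) = embed s.
  move=> xd; rewrite serve_nextE//; exists (nxt i, logit (serve_next i x)).
  by rewrite /embed /= logitK//; apply: serve_next_itv; lra.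
have last : d i <= x -> exists s, f (nxt (nxt i)) (pt i x) = embed s.
  move=> xd; rewrite serve_lastE//; exists (nxt (nxt i), logit (serve_last i x)).
  by rewrite /embed /= logitK//; apply: serve_last_itv; lra.
by case: sw => [[xd ->]|[xd ->]|[xd [->|->]]];
  [apply: next|apply: last|apply: next|apply: last]; lra.
Qed.

Let s0 : 'I_3 * R := (ord0, 0).

Lemma periodic_orbit_embed v : periodic target (branch M) s0 c v ->
  periodic_orbit lam mu d (map (@embed R) v).
Proof.
move=> [v0 vstep vloop]; split; rewrite size_map//.
  move=> n nv; rewrite !(nth_map s0)//; last exact: ltnW.
  exact/phi_embed/vstep.
by rewrite !(nth_map s0)// ?prednK//; exact/phi_embed.
Qed.

Lemma periodic_orbit_unembed u : periodic_orbit lam mu d u ->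
  exists2 v, periodic target (branch M) s0 c v & u = map (@embed R) v.
Proof.
move=> [u0 ustep uloop]; pose v := map (@unembed R) u.
have img n : (n < size u)%N -> exists s, nth 0 u n = embed s.
  by case: n => [_|n nu]; [exact: phi_image uloop | exact: phi_image (ustep n nu)].
have uv : u = map (@embed R) v.
  apply: (@eq_from_nth _ 0); first by rewrite !size_map.
  move=> n nu; rewrite (nth_map s0) ?size_map// (nth_map 0)//.
  by have [s ->] := img n nu; rewrite embedK.
exists v => //; move: ustep uloop; rewrite uv size_map => ustep uloop.
have v0 : (0 < size v)%N by rewrite size_map.
split => // [n nv|].
  apply/phi_embed; rewrite -!(nth_map s0 0)//; first exact: ustep.
  exact: ltnW.
by apply/phi_embed; rewrite -!(nth_map s0 0) ?prednK.
Qed.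

Lemma avoids_good_decision : avoids target (branch M) c -> good_decision lam mu d.
Proof.
move=> av; have [kap [H [kap01 H0 lip bnd]]] := branch_uniform M.
have [L [Lper Lall Lshadow]] := avoids_finite s0 kap01 lip bnd av.
exists (map (map (@embed R)) L); split.
- by move=> _ /mapP[v vL ->]; exact/periodic_orbit_embed/Lper.
- move=> _ /periodic_orbit_unembed[v pv ->].
  have [w wL [r r0 ->]] := Lall v pv; exists (map (@embed R) w); first exact: map_f.
  by exists 0%N, r; rewrite rot0 map_flatten map_nseq.
move=> z ztraj.
(* The initial state is dropped, as it may be a corner; thus [s t] represents [z t.+1]. *)
have /choice[s sz] t : exists s, z t.+1 = embed s.
  by have [_ /phi_image] := ztraj t.
have so : is_orbit target (branch M) c s.
  by move=> t; apply/phi_embed; rewrite -!sz; have [] := ztraj t.+1.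
have [v vL [t0 [C close]]] := Lshadow s so.
have [v0 _ _] := Lper v vL.
have unrollD n q : unroll s0 v (q * size v + n) = unroll s0 v n.
  by rewrite /unroll modnMDl.
split.
  exists (size v); split => //; exists t0.+1 => n; case: n => // n; rewrite ltnS => tn.
  rewrite addSn !sz !side_embed -(subnKC tn) -addnA.
  have [-> _] := close (n - t0 + size v)%N; have [-> _] := close (n - t0)%N.
  by rewrite addnC -[size v]mul1n unrollD.
exists (map (@embed R) v); first exact: map_f.
(* The index [n.+1] in [converges_onto] absorbs the shift by one between [z] and [s]. *)
exists t0 => n; rewrite size_map => nv.
have /andP[kap0 kap1] := kap01.
apply: (@squeeze_cvgr _ _ _ _ (fun=> 0) (geometric `|C| kap)); last 2 first.
- exact: cvg_cst.
- by apply: cvg_geometric; rewrite gtr0_norm.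
apply: nearW => t /=; apply/andP; split.
  by rewrite divr_ge0 ?sqrtr_ge0.
rewrite addnS addSn sz (nth_map s0)//.
have [e1 e2] := close (size v * t + n)%N; rewrite [(_ + t0)%N]addnC.
have uE : unroll s0 v (size v * t + n) = nth s0 v n.
  by rewrite mulnC unrollD /unroll modn_small.
rewrite uE in e1 e2; rewrite /embed e1 dist1_pt.
apply: (le_trans (expit_contract _ _)); apply: (le_trans e2).
apply: (@le_trans _ _ (`|C| * kap ^+ (size v * t + n))).
  by rewrite ler_wpM2r ?ler_norm// exprn_ge0// ltW.
rewrite ler_wpM2l//; apply: ler_wiXn2l; rewrite ?ltW//.
by apply: leq_trans (leq_addr _ _); exact: leq_pmull.
Qed.

End Triangle.

Theorem theorem3p1 (R : realType) (lam mu : 'I_3 -> R)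
  (lam_gt0 : forall i, 0 < lam i) (mu_gt0 : forall i, 0 < mu i)
  (rho_lt1 : forall i, lam i / mu i < 1)
  (rho_sum : 1 < \sum_(i < 3) lam i / mu i) :
  (@lebesgue3 R).-negligible
    [set p : (R * R) * R |
      (forall i, 0 < dvec p i < 1) /\ ~ good_decision lam mu (dvec p)].
Proof.
have lam_lt_mu i : lam i < mu i by have := rho_lt1 i; rewrite ltr_pdivrMr// mul1r.
(* The rate and the bound depend on the cap, so the decision points are exhausted by the sets whose
   logits are bounded by [n.+1], each with its own capped system. *)
pose A (n : nat) : set ('I_3 -> R) := [set c | (forall i, `|c i| <= n.+1%:R) /\
  ~ avoids target (branch lam mu n.+1%:R) c].
have A0 n : sigma_content0 (A n).
  have [kap [H [kap01 H0 lip bnd]]] := branch_uniform lam_gt0 lam_lt_mu n.+1%:R.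
  exact: (avoids_generic target kap01 lip bnd (ltr0Sn _ _) H0).
apply: negligibleS (negligible_bigcup (fun n => sigma_content0_negligible (A0 n))).
move=> p [p01 bad]; pose c i := logit (dvec p i).
pose n := Num.truncn (\sum_i `|c i|).
have cn i : `|c i| <= n.+1%:R.
  apply: (@le_trans _ _ (\sum_i `|c i|)); last exact/ltW/truncnS_gt.
  by rewrite (bigD1 i)//= lerDl sumr_ge0.
exists n => //; split => //; split => // av; apply: bad.
exact: (avoids_good_decision lam_gt0 mu_gt0 lam_lt_mu p01 cn av).
Qed.
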